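(* Let $(\Sigma_{-\beta},\sigma)$ be the $(-\beta)$-shift. Suppose that $\beta\ge\frac{1+\sqrt5}{2}$ and that $d_{-\beta}(1)$ is not periodic with odd period. Then for any $\epsilon>0$ the language $\mathcal{L}(\Sigma_{-\beta})$ admits a decomposition $\mathcal{L}(\Sigma_{-\beta})=\mathcal{G}^{\epsilon}\mathcal{C}^{s,\epsilon}$ satisfying the following properties: (I) $\mathcal{G}^{\epsilon}(M)$ has (Per)-specification for every $M\in\mathbb{N}$; (II) $h(\mathcal{C}^{s,\epsilon})\le\epsilon$.
   Context: $\mathbb{N}=\{1,2,\dots\}$. For a finite set $A$, $A^{\mathbb{N}}$ carries the product topology and $\sigma(x)_i=x_{i+1}$ is the shift. A subshift is a compact $X\subset A^{\mathbb{N}}$ with $\sigma(X)\subset X$. For a finite word $w$, $|w|$ is its length and $[w]=\{x\in X:x_1\cdots x_{|w|}=w\}$. The language $\mathcal{L}(X)$ is the set of finite words $w$ over $A$ with $[w]\neq\emptyset$; the empty word is included. For $\mathcal{D}\subset\mathcal{L}(X)$, $\mathcal{D}_n=\{w\in\mathcal{D}:|w|=n\}$ and $h(\mathcal{D})=\limsup_{n\to\infty}\frac1n\log\#\mathcal{D}_n$ (with $\log0=-\infty$). For $\mathcal{A},\mathcal{B}\subset\mathcal{L}(X)$, $\mathcal{A}\mathcal{B}=\{vw\in\mathcal{L}(X):v\in\mathcal{A},w\in\mathcal{B}\}$. Given a decomposition $\mathcal{L}(X)=\mathcal{A}\mathcal{B}$ (with $\mathcal A,\mathcal B\subset\mathcal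 L(X)$) and $M\in\mathbb{N}$, $\mathcal{A}(M)=\{vw\in\mathcal{L}(X):v\in\mathcal{A},\,w\in\mathcal{B},\,|w|\le M\}$. (Per)-specification: $\mathcal{G}\subset\mathcal{L}=\mathcal{L}(X)$ has (Per)-specification with gap size $t\in\mathbb{N}$ if for all $m\in\mathbb{N}$ and $w^1,\dots,w^m\in\mathcal{G}$ there exist $v^1,\dots,v^{m-1}\in\mathcal{L}$ with $|v^i|=t$ for all $i$ such that $x:=w^1v^1w^2v^2\cdots v^{m-1}w^m\in\mathcal{L}$, and the cylinder $[x]$ contains a periodic point of period exactly $|x|+t$, i.e. a point $y$ with $\sigma^{|x|+t}(y)=y$ (not necessarily the least period). $\mathcal{G}$ has (Per)-specification if it does so with some gap size $t$. $(-\beta)$-shift: for $\beta>1$ let $T_{-\beta}:(0,1]\to(0,1]$, $T_{-\beta}(x)=-\beta x+\lfloor\beta x\rfloor+1$, and let $A=\{1,\dots,\lfloor\beta\rfloor+1\}$. Put $I_1=(0,\frac1\beta)$, $I_i=[\frac{i-1}{\beta},\frac{i}{\beta})$ for $2\le i\le\lfloor\beta\rfloor$, and $I_{\lfloor\beta\rfloor+1}=[\frac{\lfloor\beta\rfloor}{\beta},1]$. The $(-\beta)$-expansion of $x\in(0,1]$ is $d_{-\beta}(x)\in A^{\mathbb{N}}$ with $(d_{-\beta}(x))_i=j$ iff $T_{-\beta}^{i-1}(x)\in I_j$. $\Sigma_{-\beta}$ is the closure of $\{d_{-\beta}(x):x\in(0,1]\}$ in $A^{\mathbb{N}}$; it is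 a subshift. A sequence is periodic with odd period if it equals $(w_1\cdots w_n)^\infty$ for some odd $n$. *)

(* Defs.v *)
From mathcomp Require Import all_boot all_order all_algebra.
From mathcomp Require Import all_classical all_reals all_analysis.
From mathcomp Require Import lra.

Set Implicit Arguments.
Unset Strict Implicit.
Unset Printing Implicit Defensive.

Import Order.TTheory GRing.Theory Num.Theory.

Local Open Scope classical_set_scope.
Local Open Scope ring_scope.

(* The term x_i of a sequence, i >= 1, is [x i.-1]. *)
Notation full_shift A := {ptws nat -> discrete_topology A}.

Section Language.
Variable A : finType.
Local Notation full_shift := (full_shift A).

Definition shift (x : full_shift) : full_shift := fun i => x i.+1.

Definition cylinder (X : set full_shift) (w : seq A) : set full_shift :=
  [set x | X x /\ mkseq x (size w) = w].

Definition language (X : set full_shift) : set (seq A) :=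
  [set w | cylinder X w !=set0].

Definition lang_cat (X : set full_shift) (D E : set (seq A)) : set (seq A) :=
  [set u | language X u /\ exists v w, [/\ D v, E w & u = v ++ w]].

(* With D E = L(X) a decomposition of the language, this is D(M). *)
Definition lang_ext (X : set full_shift) (D E : set (seq A)) (M : nat) :=
  lang_cat X D (E `&` [set w | (size w <= M)%N]).

Definition card_lang (D : set (seq A)) (n : nat) : nat :=
  #|[set w : n.-tuple A | `[< D w >]]|.

(* The value at n = 0 is irrelevant to the limsup; [lne 0 = -oo]. *)
Definition entropy (R : realType) (D : set (seq A)) : \bar R :=
  limn_esup (fun n => (n%:R^-1)%:E * lne (card_lang D n)%:R%:E)%E.

(* The word w^1 v^1 w^2 v^2 ... v^(m-1) w^m for m >= 1, where w^i is
   [w i.-1] and v^i is [v i.-1]; values of w and v at larger indices are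
   not used. *)
Definition glue (m : nat) (w v : nat -> seq A) : seq A :=
  flatten [seq w i ++ v i | i <- iota 0 m.-1] ++ w m.-1.

Definition per_spec_gap (X : set full_shift) (G : set (seq A)) (t : nat) :=
  forall (m : nat) (w : nat -> seq A),
    (0 < m)%N -> (forall i, (i < m)%N -> G (w i)) ->
  exists v : nat -> seq A,
    [/\ forall i, (i < m.-1)%N -> language X (v i) /\ size (v i) = t,
        language X (glue m w v) &
        exists2 y, cylinder X (glue m w v) y &
          iter (size (glue m w v) + t) shift y = y].

Definition per_specification (X : set full_shift) (G : set (seq A)) :=
  exists2 t, (0 < t)%N & per_spec_gap X G t.

(* x = (w_1 ... w_n)^oo with n odd; in particular w is nonempty, so that the
   default value of [nth] is not used. *)
Definition odd_periodic (x : full_shift) :=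
  exists2 w : seq A, odd (size w) & forall i, x i = nth (x 0) w (i %% size w).

End Language.

Section NegativeBetaShift.
Variables (R : realType) (beta : R).

Definition negbeta_map (x : R) : R :=
  - beta * x + (Num.floor (beta * x))%:~R + 1.

(* The letter j in {1, ..., floor beta + 1} is encoded by the ordinal j - 1. *)
Definition negbeta_alphabet : finType := 'I_(Num.truncn beta).+1.

(* I_(j+1) in the numbering of the intervals by 1, ..., floor beta + 1. *)
Definition negbeta_itv (j : negbeta_alphabet) : interval R :=
  if j == ord_max then `[(Num.truncn beta)%:R / beta, 1]
  else if j == ord0 then `]0, 1 / beta[
  else `[j%:R / beta, j.+1%:R / beta[.

Definition negbeta_expansion (x : R) : full_shift negbeta_alphabet :=
  fun i => odflt ord0 [pick j | iter i negbeta_map x \in negbeta_itv j].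

Definition negbeta_shift : set (full_shift negbeta_alphabet) :=
  closure [set negbeta_expansion x | x in `]0, 1]].

Lemma negbeta_map_itv (x : R) : negbeta_map x \in `]0, 1].
Proof.
have /andP[xge xlt] := floor_itv (beta * x).
rewrite in_itv /= /negbeta_map mulNr; move: xge xlt; rewrite intrD.
by move: (_%:~R) => m xge xlt; apply/andP; split; lra.
Qed.

Lemma negbeta_itvP (x : R) (j : negbeta_alphabet) :
  1 < beta -> x \in `]0, 1] ->
  (x \in negbeta_itv j) = (Num.truncn (beta * x) == j).
Proof.
move=> b1; rewrite in_itv /= => /andP[x0 x1].
have b0 : 0 < beta by lra.
have bx0 : 0 <= beta * x by rewrite mulr_ge0 // ltW.
have nP : (0 < Num.truncn beta)%N by rewrite truncn_gt0 ltW.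
rewrite truncn_eq // /negbeta_itv; case: (j =P ord_max) => [->|/eqP jmax].
  rewrite in_itv /= ler_pdivrMr // x1 andbT mulrC.
  suff -> : beta * x < (Num.truncn beta).+1%:R by rewrite andbT.
  by apply: le_lt_trans (truncnS_gt beta); rewrite ler_piMr // ltW.
case: (j =P ord0) => [->|_].
  by rewrite in_itv /= x0 ltr_pdivlMr // bx0 mulrC.
by rewrite in_itv /= ler_pdivrMr // ltr_pdivlMr // mulrC.
Qed.

Lemma negbeta_expansionP (x : R) (i : nat) (j : negbeta_alphabet) :
  1 < beta -> x \in `]0, 1] ->
  negbeta_expansion x i = j <-> iter i negbeta_map x \in negbeta_itv j.
Proof.
move=> b1 x01; have y01 : iter i negbeta_map x \in `]0, 1].
  by case: i => // i; rewrite iterS negbeta_map_itv.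
rewrite /negbeta_expansion; move: (iter i _ x) y01 => y y01.
case: pickP => [k|noj] /=.
  rewrite !negbeta_itvP // => /eqP ->; split=> [->//|/eqP/val_inj //].
have ltb : (Num.truncn (beta * y) < (Num.truncn beta).+1)%N.
  move: y01; rewrite in_itv /= => /andP[_ y1]; rewrite ltnS le_truncn //.
  by rewrite ler_piMr // ltW // (lt_trans _ b1).
by have := noj (Ordinal ltb); rewrite negbeta_itvP ?eqxx.
Qed.

End NegativeBetaShift.

Arguments negbeta_shift {R} beta.
Arguments negbeta_alphabet {R} beta.

(* Main.v *)
(* Let omega = d(1). A word of the language is cut, from the right, into a word
   without any suffix that is a prefix of omega of length > N (these words form
   G) followed by a concatenation of prefixes of omega of length > N (these form
   C). A word of C is determined by the lengths of its factors, all > N, so C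
   has arbitrarily small entropy for large N.

   A word w acts on points by inverse branches of T, and the points on which it
   acts depend only on its longest suffix that is a prefix of omega; for the
   words of G(M) this suffix has bounded length. The cylinder of a prefix of
   omega contains some (1 - e, 1), because d(1) is not periodic with odd period.
   For beta above the golden mean every interval has a subinterval that an
   iterate of T maps onto (0, 1) in a single branch, so every w in G(M) extends
   by a word of bounded length to a block after which any expansion may follow.
   At the golden mean the shift is the even shift and no such extension exists
   after the last letter; there every word is completed on both sides. *)

Require Import Defs.
From mathcomp Require Import all_boot all_order all_algebra.
From mathcomp Require Import all_classical all_reals all_analysis.
From mathcomp Require Import ring lra.
Import Order.TTheory GRing.Theory Num.Theory.
Local Open Scope classical_set_scope.
Local Open Scope ring_scope.

Set Implicit Arguments.
Unset Strict Implicit.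
Unset Printing Implicit Defensive.

Lemma flatten_map_iotaS (A : Type) (f : nat -> seq A) m :
  flatten [seq f i | i <- iota 0 m.+1] =
  flatten [seq f i | i <- iota 0 m] ++ f m.
Proof. by rewrite -addn1 iotaD map_cat flatten_cat /= cats0. Qed.

(** * Languages of subshifts, and a block criterion for (Per)-specification *)

Section Words.
Variable A : finType.
Implicit Types (x y : full_shift A) (S X : set (full_shift A)).
Local Notation sigma := (@Defs.shift A).

Lemma nbhs_prefix x n :
  nbhs x [set y : full_shift A | forall i, (i < n)%N -> y i = x i].
Proof.
elim: n => [|n IH]; first by apply: filterS (filterT) => y _ i.
have hn : nbhs x [set y : full_shift A | y n = x n].
  have := @proj_continuous nat (fun=> discrete_topology A) n x [set x n].
  by apply; exact: discrete_set1.
apply: filterS (filterI IH hn) => y [yx yn] i.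
by rewrite ltnS leq_eqVlt => /orP[/eqP->//|]; exact: yx.
Qed.

Lemma closure_prefixP S x :
  closure S x <-> forall n, exists2 y, S y & forall i, (i < n)%N -> y i = x i.
Proof.
split=> [clx n|appr].
  by have [y [Sy yx]] := clx _ (nbhs_prefix x n); exists y.
pose g n := s2val (cid2 (appr n)).
have Sg n : S (g n) by rewrite /g; case: cid2.
have gx n i : (i < n)%N -> g n i = x i by rewrite /g; case: cid2 => y; auto.
have gcvg : (g : nat -> full_shift A) @ \oo --> x.
  apply/cvg_sup => i U [V] [[W] oW <-] Wxi WU.
  exists i.+1 => // n /= lt_in; apply: WU => /=.
  by rewrite gx.
move=> B /gcvg [n _ gB]; exists (g n); split; first exact: Sg.
by apply: gB => /=.
Qed.

Lemma iter_shiftE x m i : iter m sigma x i = x (m + i)%N.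
Proof. by elim: m i => [//|m IH] i /=; rewrite /Defs.shift IH addnS addSn. Qed.

Lemma mkseqD x m n :
  mkseq x (m + n)%N = mkseq x m ++ mkseq (iter m sigma x) n.
Proof.
rewrite /mkseq iotaD map_cat add0n -[X in iota X n]addn0 iotaDl -map_comp.
by congr (_ ++ _); apply: eq_map => i; rewrite /= iter_shiftE.
Qed.

Lemma language_factor X (p q r : seq A) : 
  (forall x, X x -> X (sigma x)) ->
  language X (p ++ q ++ r) -> language X q.
Proof.
move=> Xshift [x [Xx]]; rewrite !size_cat !mkseqD => /eqP.
rewrite !eqseq_cat ?size_mkseq // => /and3P[_ /eqP <- _].
exists (iter (size p) sigma x); split; last by rewrite size_mkseq.
by elim: (size p) => //= n; exact: Xshift.
Qed.

Lemma closed_prefix X x :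
  closed X -> (forall n, language X (mkseq x n)) -> X x.
Proof.
move=> Xcl Lx; apply/Xcl/closure_prefixP => n.
have [y [Xy]] := Lx n; rewrite size_mkseq => yx; exists y => // i lt_in.
by rewrite -(nth_mkseq (x 0%N) y lt_in) yx nth_mkseq.
Qed.

(** Gluing with the connecting words [r i ++ l i.+1] is concatenating the blocks, up to the
    outermost [l] and [r]. *)
Lemma glue_blocks (w l r : nat -> seq A) m :
  l 0%N ++ Defs.glue m.+1 w (fun i => r i ++ l i.+1) ++ r m =
  flatten [seq l i ++ w i ++ r i | i <- iota 0 m.+1].
Proof.
elim: m => [|m IH]; first by rewrite /= cats0.
rewrite flatten_map_iotaS -IH /Defs.glue.
by rewrite !succnK flatten_map_iotaS -!catA.
Qed.

(* A word that completes to a block [l ++ w ++ r] is followed by [r] and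
   preceded by [l]; the periodic point repeats the concatenated blocks, read
   from the end of the first [l]. *)
Lemma blocks_per_specification X (B G : set (seq A)) (a b : nat) :
    closed X -> (forall x, X x -> X (sigma x)) ->
    B `<=` language X -> (forall p q, B p -> B q -> B (p ++ q)) ->
    (0 < a + b)%N ->
    (forall w, G w ->
       exists l r, [/\ size l = a, size r = b & B (l ++ w ++ r)]) ->
  per_specification X G.
Proof.
move=> Xcl Xshift BL Bcat ab0 GB; exists (a + b)%N => // -[//|m] w _ Gw.
have /choice[lr lrP] : forall i, exists p : seq A * seq A, (i <= m)%N ->
    [/\ size p.1 = a, size p.2 = b & B (p.1 ++ w i ++ p.2)].
  move=> i; case: (leqP i m) => [le_im|_]; last by exists ([::], [::]).
  by have [l [r lrP]] := GB _ (Gw i le_im); exists (l, r).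
pose l i := (lr i).1; pose r i := (lr i).2.
pose v i := r i ++ l i.+1; pose g := Defs.glue m.+1 w v.
pose F k := flatten [seq l i ++ w i ++ r i | i <- iota 0 k].
have gF : l 0%N ++ g ++ r m = F m.+1 by rewrite glue_blocks.
have BF k : (k <= m)%N -> B (F k.+1).
  elim: k => [|k IH] le_km; first by rewrite /F /= cats0; case: (lrP 0%N).
  rewrite /F flatten_map_iotaS.
  by apply: Bcat; [exact/IH/ltnW | case: (lrP k.+1)].
have LF := BL _ (BF _ (leqnn m)).
have Lg : language X g.
  by apply: (@language_factor _ (l 0%N) g (r m)) => //; rewrite gF.
exists v; split=> //.
  move=> i /= lt_im; split; last first.
    rewrite size_cat; case: (lrP i) => [|_ -> _]; first exact: ltnW.
    by case: (lrP i.+1) => // -> _ _; rewrite addnC.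
  have -> : v i = r i ++ l i.+1 by [].
  (* [v i] sits between [w i] and [w i.+1] in the concatenation of all blocks. *)
  apply: (@language_factor _ (F i ++ l i ++ w i) _
            (w i.+1 ++ r i.+1 ++ flatten [seq l j ++ w j ++ r j |
               j <- iota i.+2 (m - i.+1)])) => //.
  move: LF; have {1}-> : m.+1 = (i + (m - i.+1).+2)%N.
    by rewrite -addSnnS -addSnnS addSn subnKC.
  by rewrite /F iotaD map_cat flatten_cat /= add0n -!catA.
pose W := g ++ r m ++ l 0%N; pose N := size W.
have sizeW : N = (size g + (a + b))%N.
  rewrite /N !size_cat; case: (lrP m) => // _ -> _.
  by case: (lrP 0%N) => // -> _ _; rewrite [(b + a)%N]addnC.
have N0 : (0 < N)%N by rewrite sizeW (leq_trans ab0) // leq_addl.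
have [y0 _] := Lg.
(* The default letter [y0 0] is never read, since [i %% N < N]. *)
pose y : full_shift A := fun i => nth (y0 0%N) W (i %% N).
have yper : iter N sigma y = y.
  by apply/funext => i; rewrite iter_shiftE /y modnDl.
have yW : mkseq y N = W.
  apply: (@eq_from_nth _ (y0 0%N)) => [|i]; rewrite size_mkseq // => lt_iN.
  by rewrite nth_mkseq // /y modn_small.
have yWk k : mkseq y (k * N)%N = flatten (nseq k W).
  by elim: k => //= k IH; rewrite mulSn mkseqD yW yper IH.
(* The period [W] is the block word [F m.+1] rotated by [l 0]. *)
have WF k : l 0%N ++ flatten (nseq k W) = flatten (nseq k (F m.+1)) ++ l 0%N.
  elim: k => [|k IH]; first by rewrite cats0.
  by rewrite /= -catA -IH -gF /W -!catA.
have LFk k : language X (flatten (nseq k.+1 (F m.+1))).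
  apply: BL; elim: k => [|k IH]; first by rewrite /= cats0; exact: BF.
  by apply: Bcat => //; exact: BF.
have Xy : X y.
  apply: closed_prefix => // n.
  (* The prefix of length [n] lies in [W^n]; with [l 0] before [W^n] and [g ++ r m] after it, the
     whole is [n + 1] copies of [F m.+1]. *)
  apply: (@language_factor _ (l 0%N) _
    (mkseq (iter n sigma y) (n * N - n)%N ++ g ++ r m)) => //.
  rewrite [mkseq y n ++ _]catA -mkseqD subnKC ?leq_pmulr // yWk.
  rewrite catA WF -catA gF.
  have -> : flatten (nseq n (F m.+1)) ++ F m.+1 = flatten (nseq n.+1 (F m.+1)).
    by elim: n => [|k IH]; rewrite /= ?cats0 // -catA IH.
  exact: LFk.
exists y; last by rewrite -sizeW.
split=> //; have := yW; rewrite sizeW mkseqD /W => /eqP.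
by rewrite eqseq_cat ?size_mkseq // => /andP[/eqP].
Qed.

End Words.

(** * Cutting words along prefixes of a sequence, and counting the pieces *)

Section PrefixConcatenations.
Variables (A : finType) (om : nat -> A).
Implicit Types (v w c p : seq A).

Definition no_prefix_suffix (N : nat) : set (seq A) :=
  [set w | forall k p, (N < k)%N -> w <> p ++ mkseq om k].

Definition prefix_concat (N : nat) : set (seq A) :=
  [set c | exists2 ks, all (ltn N) ks & c = flatten [seq mkseq om k | k <- ks]].

(** Removing [c] from a suffix that is a prefix of [om] leaves a shorter prefix of [om], now a
    suffix of [v]. This bounds such suffixes for the words of G(M). *)
Lemma no_prefix_suffix_cat N v c :
  no_prefix_suffix N v -> no_prefix_suffix (N + size c) (v ++ c).
Proof.
move=> Nv k p lt_k vc.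
have le_ck : (size c <= k)%N by apply: leq_trans (ltnW lt_k); rewrite leq_addl.
apply: (Nv (k - size c)%N p); first by rewrite ltn_subRL addnC.
have := vc; rewrite -{1}(subnK le_ck) /mkseq iotaD map_cat catA => vcE.
have /eqP := congr1 size vcE; rewrite !size_cat !size_map !size_iota eqn_add2r.
move=> /eqP szv; move/eqP: vcE; rewrite eqseq_cat => [/andP[/eqP-> //]|].
by rewrite szv size_cat size_map size_iota.
Qed.

(** The empty prefix is always a suffix, so a longest one exists; the word is split there in order
    to apply [reaches_pullback]. *)
Lemma longest_prefix_suffix K w : no_prefix_suffix K w ->
  exists k p, [/\ (k <= K)%N, w = p ++ mkseq om k & no_prefix_suffix k w].
Proof.
elim: K => [|K IH] Kw; first by exists 0%N, w; rewrite cats0.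
have [[p wE]|no] := pselect (exists p, w = p ++ mkseq om K.+1).
  by exists K.+1, p.
have [k p lt_k wE|k [p [le_kK wE kw]]] := IH; last by exists k, p; split; auto.
move: lt_k; rewrite leq_eqVlt => /orP[/eqP kE|/Kw/(_ wE)//].
by case: no; exists p; rewrite kE.
Qed.

(** Greedy cutting: as long as some suffix is a prefix of [om] longer than [N], strip it; the word
    gets shorter each time. *)
Lemma prefix_decomposition N w :
  exists v c, [/\ no_prefix_suffix N v, prefix_concat N c & w = v ++ c].
Proof.
have [n] := ubnP (size w); elim: n w => // n IH w; rewrite ltnS => le_wn.
have [Nw|] := pselect (no_prefix_suffix N w).
  by exists w, [::]; split; [|exists [::]|rewrite cats0].
move/existsNP => [k /existsNP[p /not_implyP[lt_Nk /contrapT wE]]].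
have [|v [c [Nv [ks Nks cE] pE]]] := IH p.
  apply: leq_trans le_wn; rewrite wE size_cat size_mkseq.
  by rewrite -[X in (X < _)%N]addn0 ltn_add2l (leq_trans _ lt_Nk).
exists v, (c ++ mkseq om k); split; [by []| |by rewrite wE pE catA].
exists (rcons ks k); first by rewrite all_rcons /= lt_Nk.
by rewrite map_rcons flatten_rcons cE.
Qed.

(** Splitting off the first factor, of length [n + 1 - j > N], gives the recursion c(n+1) <= c(0) +
    ... + c(n-N) for the counts; the bound [lam ^+ j] survives it by a geometric sum. *)
Lemma prefix_concat_enum (R : realType) (lam : R) N n :
    1 < lam -> 1 <= (lam - 1) * lam ^+ N ->
  exists2 s : seq (seq A), (size s)%:R <= lam ^+ n &
    forall c, prefix_concat N c -> size c = n -> c \in s.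
Proof.
move=> lam1 lamN; have lam0 : 0 < lam by lra.
have [m] := ubnP n; elim: m n => // m IH n; rewrite ltnS => le_nm.
case: n le_nm => [|n] le_nm.
  by exists [:: [::]] => // c _ /size0nil ->; rewrite inE.
have /choice[s sP] : forall j, exists s : seq (seq A), (j <= n)%N ->
    (size s)%:R <= lam ^+ j /\
    forall c, prefix_concat N c -> size c = j -> c \in s.
  move=> j; case: (leqP j n) => [le_jn|_]; last by exists [::].
  by have [s ? ?] := IH j (leq_ltn_trans le_jn le_nm); exists s.
pose t := flatten [seq [seq mkseq om (n.+1 - j) ++ c | c <- s j] |
                     j <- iota 0 (n.+1 - N)].
exists t.
  (* Multiplied by [lam - 1], the geometric sum telescopes. *)
  suff : (lam - 1) * (size t)%:R <= (lam - 1) * lam ^+ n.+1.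
    by rewrite ler_pM2l //; lra.
  have le_t : forall k, (k <= n.+1)%N -> (lam - 1) *
      (size (flatten [seq [seq mkseq om (n.+1 - j) ++ c | c <- s j] |
        j <- iota 0 k]))%:R <= lam ^+ k - 1.
    elim=> [|k IHk] lt_kn; first by rewrite expr0 /= mulr0 subrr.
    rewrite flatten_map_iotaS size_cat size_map natrD mulrDr.
    have [sk _] := sP k lt_kn; have := IHk (ltnW lt_kn).
    have : (lam - 1) * (size (s k))%:R <= (lam - 1) * lam ^+ k.
      by rewrite ler_pM2l //; lra.
    by rewrite exprS; lra.
  have := le_t _ (leq_subr N n.+1).
  rewrite -/t; case: (leqP N n.+1) => [le_N|lt_N].
    have : lam ^+ (n.+1 - N) <= (lam - 1) * lam ^+ n.+1.
      rewrite -{2}(subnK le_N) exprD [_ * lam ^+ N]mulrC mulrA.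
      by rewrite ler_peMl // exprn_ge0 // ltW.
    by lra.
  have -> : (n.+1 - N = 0)%N by apply/eqP; rewrite subn_eq0 ltnW.
  rewrite expr0 subrr => /le_trans; apply.
  by rewrite mulr_ge0 ?exprn_ge0 //; lra.
move=> c [[|k ks] /= Nks ->]; first by [].
move/andP: Nks => [lt_Nk Nks]; rewrite size_cat size_mkseq => sz.
apply/flatten_mapP; set c' := flatten _ in sz *.
have szc : size c' = (n.+1 - k)%N by rewrite -sz addKn.
have k0 : (0 < k)%N by apply: leq_trans lt_Nk.
have le_kn : (k <= n.+1)%N by rewrite -sz leq_addr.
exists (size c').
  rewrite mem_iota add0n /= szc ltn_sub2l //.
  exact: leq_trans lt_Nk le_kn.
apply/mapP; exists c'; last by rewrite szc subKn.
have [|_] := sP (size c'); last by apply=> //; exists ks.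
by rewrite szc leq_subLR -add1n leq_add2r.
Qed.

End PrefixConcatenations.

(** Every single term of the limsup is at most [eps], by the count with [lam = expR eps]. *)
Lemma entropy_prefix_concat_le (R : realType) (A : finType) (om : nat -> A)
    (C : set (seq A)) (eps : R) N :
    0 < eps -> 1 <= (expR eps - 1) * expR eps ^+ N ->
  C `<=` prefix_concat om N -> (entropy R C <= eps%:E)%E.
Proof.
move=> eps0 epsN CN; have lam1 : 1 < expR eps by rewrite expR_gt1.
rewrite /entropy limn_esup_lim; apply: lime_le; first exact: is_cvg_esups.
apply: nearW => k; apply: ge_ereal_sup => _ [n _ <-].
have [s ss sP] := @prefix_concat_enum _ om R _ _ n lam1 epsN.
have card_le : (card_lang C n <= size s)%N.
  rewrite /card_lang cardE -(size_map val); apply: uniq_leq_size.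
    by rewrite map_inj_uniq ?enum_uniq //; exact: val_inj.
  move=> _ /mapP[w + ->]; rewrite mem_enum inE => /asboolP Cw.
  by apply: sP; [exact: CN|rewrite size_tuple].
have [->|card0] := posnP (card_lang C n).
  (* At [n = 0] the factor [n^-1] is 0 and so is the term; for larger [n] an empty count gives
     -oo. *)
  rewrite le0_lneNy //; case: n {ss sP card_le} => [|n].
    by rewrite invr0 mul0e lee_fin ltW.
  by rewrite gt0_muleNy ?leNye // lte_fin invr_gt0 ltr0n.
have card0' : 0 < (card_lang C n)%:R :> R by rewrite ltr0n.
rewrite lne_EFin // -EFinM lee_fin.
case: n ss card_le card0 card0' {sP} => [|n] ss card_le card0 card0'.
  by rewrite invr0 mul0r ltW.
rewrite ler_pdivrMl ?ltr0n // -ler_expR lnK ?posrE //.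
rewrite expRM_natl.
by apply: le_trans ss; rewrite ler_nat.
Qed.

(** By Bernoulli's inequality. *)
Lemma exprn_unbounded (R : realType) (M rho : R) :
  1 < rho -> exists n, M < rho ^+ n.
Proof.
move=> rho1; exists (Num.truncn (M / (rho - 1))).+1.
set n := _.+1; have : M < n%:R * (rho - 1).
  by rewrite -ltr_pdivrMr ?subr_gt0 //; exact: truncnS_gt.
suff : 1 + n%:R * (rho - 1) <= rho ^+ n by lra.
elim: n => [|n IH]; first by rewrite mul0r addr0 expr0.
apply: (@le_trans _ _ (rho * (1 + n%:R * (rho - 1)))).
  have : 0 <= n%:R * (rho - 1) ^+ 2 by rewrite mulr_ge0 ?sqr_ge0.
  by rewrite expr2 -natr1; lra.
by rewrite exprS ler_pM2l //; lra.
Qed.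

(** * Branches of [T], cylinders and the language of the shift *)

Section NegativeBetaShift.
Variables (R : realType) (beta : R).
Hypothesis beta_gt1 : 1 < beta.
Local Notation T := (negbeta_map beta).
Local Notation d := (negbeta_expansion beta).
Local Notation om := (negbeta_expansion beta 1).
Local Notation X := (negbeta_shift beta).
Local Notation alphabet := (negbeta_alphabet beta).
Implicit Types (x y z l r : R) (a : alphabet) (p q s w : seq alphabet).
Implicit Types U V : set R.

Lemma negbeta_map_bounds x : 0 < T x <= 1.
Proof. by have := negbeta_map_itv beta x. Qed.

Lemma iter_negbeta_map_itv x n : 0 < x <= 1 -> 0 < iter n T x <= 1.
Proof. by case: n => // n _; exact: negbeta_map_bounds. Qed.

Lemma negbeta_branch x n : 0 < x <= 1 -> n%:R <= beta * x < n.+1%:R ->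
  d x 0%N = n :> nat /\ T x = n.+1%:R - beta * x.
Proof.
have b1 := beta_gt1.
move=> x01 nx; have bx0 : 0 <= beta * x by case/andP: nx => + _;
  exact: le_trans.
have := (negbeta_expansionP 0 (d x 0%N) beta_gt1 x01).1 erefl.
rewrite negbeta_itvP // => /eqP <-; split; first by apply/eqP;
  rewrite truncn_eq.
rewrite /negbeta_map (@floor_def _ _ n%:Z) ?intrD -?natrD ?addn1 //.
by rewrite -natr1; lra.
Qed.

Lemma negbeta_branchP x : 0 < x <= 1 ->
  exists n, [/\ n%:R <= beta * x < n.+1%:R, d x 0%N = n :> nat,
                T x = n.+1%:R - beta * x & (n <= Num.truncn beta)%N].
Proof.
have b1 := beta_gt1.
move=> x01; have bx0 : 0 <= beta * x by case/andP: x01 => ? ?; apply: mulr_ge0;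
  lra.
have nx := trunc_itv bx0; have [dE TE] := negbeta_branch x01 nx.
by exists (Num.truncn (beta * x)); split; rewrite // -dE -ltnS.
Qed.

Lemma iter_shift_expansion n x : iter n (@Defs.shift _) (d x) = d (iter n T x).
Proof.
by apply/funext => i; rewrite iter_shiftE /negbeta_expansion addnC iterD.
Qed.

Lemma mkseq_expansionD x m n :
  mkseq (d x) (m + n)%N = mkseq (d x) m ++ mkseq (d (iter m T x)) n.
Proof. by rewrite mkseqD iter_shift_expansion. Qed.

Lemma mkseq_expansion_cons x n :
  mkseq (d x) n.+1 = d x 0%N :: mkseq (d (T x)) n.
Proof. by rewrite -add1n mkseq_expansionD. Qed.

Lemma negbeta_shift_closed : closed X.
Proof. exact: closed_closure. Qed.

Lemma negbeta_shift_invariant (x : full_shift alphabet) : X x -> X (Defs.shift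
  x).
Proof.
move=> /closure_prefixP Xx; apply/closure_prefixP => n.
have [_ [y y01 <-] yx] := Xx n.+1; exists (d (T y)).
  by exists (T y) => //; exact: negbeta_map_itv.
by move=> i lt_in; rewrite /Defs.shift -yx // -[d (T y)](iter_shift_expansion
  1).
Qed.

Lemma negbeta_languageP w :
  language X w <-> exists2 x, 0 < x <= 1 & mkseq (d x) (size w) = w.
Proof.
split=> [[x [/closure_prefixP Xx xw]]|[x x01 xw]]; last first.
  by exists (d x); split=> //; apply: subset_closure; exists x;
    rewrite //= in_itv.
have [_ [y y01 <-] yx] := Xx (size w); exists y;
  first by rewrite /= in_itv in y01.
by rewrite -{2}xw; apply/eq_in_map => i; rewrite mem_iota => /andP[_ /yx].
Qed.

Lemma negbeta_preimage a x z : 0 < x <= 1 -> 0 < z <= 1 ->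
  beta * z = a.+1%:R - x -> d z 0%N = a /\ T z = x.
Proof.
move=> x01 z01 bz; have [|dE TE] := @negbeta_branch z a z01.
  by rewrite bz -natr1; lra.
by split; [exact: val_inj|rewrite TE bz opprB addrCA subrr addr0].
Qed.

(** [T] is decreasing on each branch, so the induction hypothesis is used with the two endpoints
    exchanged. *)
Lemma negbeta_cylinder_convex n x y z : 0 < x -> x <= y <= z -> z <= 1 ->
  mkseq (d x) n = mkseq (d z) n -> mkseq (d y) n = mkseq (d z) n.
Proof.
have b1 := beta_gt1.
elim: n x y z => [//|n IH] x y z x0 /andP[xy yz] z1.
rewrite !mkseq_expansion_cons => -[dxz xz].
have [x01 y01 z01] : [/\ 0 < x <= 1, 0 < y <= 1 & 0 < z <= 1] by split; lra.
have [i [xi dx Tx _]] := negbeta_branchP x01.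
have [j [zj dz Tz _]] := negbeta_branchP z01.
have ij : i = j by rewrite -dx -dz dxz.
have bxy : beta * x <= beta * y by rewrite ler_pM2l //; lra.
have byz : beta * y <= beta * z by rewrite ler_pM2l //; lra.
have [|dy Ty] := @negbeta_branch y j y01; first by rewrite -{1}ij; lra.
congr (_ :: _); first by apply: val_inj; rewrite /= dy dz.
rewrite -xz; apply: (IH (T z)); rewrite ?xz //.
- by case/andP: (negbeta_map_bounds z).
- by rewrite Tx Ty Tz ij; lra.
by case/andP: (negbeta_map_bounds x).
Qed.

(* The branch labelled [a] misses [x] only if [a] is the last letter and
   [x <= T 1]; cylinders being intervals, [T 1] then has the prefix [q]. *)
Lemma negbeta_pullback a q x :
    language X (a :: q) -> a :: q <> mkseq om (size q).+1 ->
    0 < x < 1 -> mkseq (d x) (size q) = q ->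
  exists z, [/\ 0 < z < 1, d z 0%N = a & T z = x].
Proof.
have b1 := beta_gt1.
move=> /negbeta_languageP[y y01 + noprefix x01 xq].
rewrite mkseq_expansion_cons => -[dy yq]; have b0 : 0 < beta by lra.
suff ab : a.+1%:R - x < beta.
  pose z := (a.+1%:R - x) / beta.
  have bz : beta * z = a.+1%:R - x by rewrite mulrC divfK // gt_eqF.
  have a0 : 0 <= a%:R :> R by [].
  have z01 : 0 < z < 1.
    by rewrite -(pmulr_rgt0 z b0) -[z < 1](ltr_pM2l b0) bz; move: ab;
      rewrite -natr1; lra.
  have [||dz Tz] := @negbeta_preimage a x z _ _ bz; try lra.
  by exists z.
have mb := @trunc_itv _ beta (ltW b0); set m := Num.truncn beta in mb.
have [am|am] := eqVneq a ord_max; last first.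
  have : a.+1%:R <= m%:R :> R.
    by rewrite ler_nat ltn_neqAle -ltnS ltn_ord andbT (inj_eq val_inj a
      ord_max).
  by lra.
have one01 : 0 < (1 : R) <= 1 by lra.
have [|d1 T1] := @negbeta_branch 1 m one01; first by rewrite mulr1.
have am' : a = m :> nat by rewrite am.
suff : T 1 < x by rewrite T1 am'; lra.
(* Otherwise [x <= T 1 <= T y] with [y] in the cylinder of [a :: q]; since [x] and [T y] share the
   prefix [q], so does [T 1]. *)
rewrite ltNge; apply/negP => xT1; apply: noprefix.
have [n [yn dyn Ty _]] := negbeta_branchP y01.
have nm : n = m by rewrite -dyn dy.
have by1 : beta * y <= beta * 1 by rewrite ler_pM2l //; lra.
rewrite mkseq_expansion_cons (@negbeta_cylinder_convex _ x _ (T y)) ?yq ?xq //.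
- by congr (_ :: _); apply: val_inj; rewrite /= d1.
- by lra.
- by rewrite xT1 T1 Ty nm; lra.
by case/andP: (negbeta_map_bounds y).
Qed.

(** * Words as inverse branches of the iterates of [T] *)

Definition reaches U w V :=
  forall x, V x -> exists z, [/\ U z, mkseq (d z) (size w) = w & iter (size w)
    T z = x].

Lemma reaches_cat U V W p q :
  reaches U p V -> reaches V q W -> reaches U (p ++ q) W.
Proof.
move=> UV VW x /VW[y [/UV[z [Uz zp zy]] yq yx]]; exists z; split=> //.
  by rewrite size_cat mkseq_expansionD zp zy yq.
by rewrite size_cat addnC iterD zy.
Qed.

Lemma reaches_subset U V U' V' w :
  U `<=` U' -> V' `<=` V -> reaches U w V -> reaches U' w V'.
Proof. by move=> UU VV Uw x /VV/Uw[z [/UU]]; exists z. Qed.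

Lemma reaches_nil U : reaches U [::] U.
Proof. by move=> x Ux; exists x. Qed.

Lemma reaches_language U V w : U `<=` `]0, 1] -> V !=set0 ->
  reaches U w V -> language X w.
Proof.
move=> U01 [x Vx] /(_ x Vx)[z [/U01 z01 zw _]]; apply/negbeta_languageP.
by exists z => //; move: z01; rewrite /= in_itv.
Qed.

(** The letters of [p] are prepended from right to left. Each word obtained is a suffix longer than
    [s], hence not a prefix of [om], and [negbeta_pullback] applies. *)
Lemma reaches_pullback V p s w :
    language X (p ++ s) -> no_prefix_suffix om (size s) (p ++ s) ->
    reaches `]0, 1[ (s ++ w) V ->
  reaches `]0, 1[ (p ++ s ++ w) V.
Proof.
move=> + + sV; elim: p => [//|a p IH] Lw nw x Vx.
have [|k p' lt_k psE|z [z01 zw zx]] := IH _ _ x Vx; last 1 first.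
- have [|||y [y01 dy Ty]] := negbeta_pullback Lw _ _ _ (x := z).
  + by apply: (nw _ [::]); rewrite ltnS size_cat leq_addl.
  + by move: z01; rewrite /= in_itv.
  + have := zw; rewrite catA size_cat mkseq_expansionD => /eqP.
    by rewrite eqseq_cat ?size_mkseq // => /andP[/eqP].
  exists y; split; first by rewrite /= in_itv.
    by rewrite /= -/(mkseq _ _.+1) mkseq_expansion_cons dy Ty zw.
  by rewrite /= -iterS iterSr Ty.
- by apply: (@language_factor _ _ [:: a] _ [::]);
  [exact: negbeta_shift_invariant|rewrite cats0].
- by apply: (nw k (a :: p') lt_k); rewrite /= psE.
Qed.

(** Near 1 the iterate [T^k] is affine with slope [(- beta) ^+ k]. For odd [k] it approaches [T^k 1]
    from above, which is harmless since branches are open on the right; for even [k] from below,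
    where [T^k 1] must not be a left endpoint. *)
Lemma prefix_near1 : ~ odd_periodic om -> forall k,
  exists2 e, 0 < e < 1 & forall x, 1 - e < x <= 1 ->
    mkseq (d x) k = mkseq om k /\
    iter k T x = iter k T 1 - (- beta) ^+ k * (1 - x).
Proof.
have b1 := beta_gt1.
move=> noper; elim=> [|k [e e01 IH]].
  by exists (1 / 2) => [|x _];
    [lra|rewrite /= expr0 mul1r opprB addrCA subrr addr0].
have y01 : 0 < iter k T 1 <= 1 by apply: iter_negbeta_map_itv; lra.
have [n [ny dy Ty _]] := negbeta_branchP y01;
  set y := iter k T 1 in y01 ny dy Ty IH.
have bk : 0 < beta ^+ k.+1 by rewrite exprn_gt0 //; lra.
(* At a left endpoint [beta * y = n] one gets [T^(k+1) 1 = 1], so [om] would have the odd period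
   [k + 1]. *)
have nyk : ~~ odd k -> n%:R < beta * y.
  move=> ek; rewrite lt_neqAle; case/andP: ny => -> _; rewrite andbT.
  apply/eqP => nyE; apply: noper; exists (mkseq om k.+1);
    first by rewrite size_mkseq.
  have T1 : iter k.+1 T 1 = 1 by rewrite iterS -/y Ty -nyE -natr1 addrAC subrr
    add0r.
  move=> i; rewrite size_mkseq nth_mkseq ?ltn_mod //.
  have per j : om (i %% k.+1 + j * k.+1)%N = om (i %% k.+1)%N.
    elim: j => [|j IHj]; first by rewrite addn0.
    by rewrite mulSn addnCA -iter_shiftE iter_shift_expansion T1.
  by rewrite {1}(divn_eq i k.+1) addnC per.
(* The second bound is the distance from [y] to the branch end on the side of approach, divided by
   the expansion [beta ^+ k]. *)
pose f := Num.min e (if odd k then (n.+1%:R - beta * y) / beta ^+ k.+1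
                     else (beta * y - n%:R) / beta ^+ k.+1).
have f0 : 0 < f.
  rewrite lt_min; case/andP: e01 => -> _ /=.
  by case: ifPn => ok; rewrite divr_gt0 //; [case/andP: ny|have := nyk ok]; lra.
exists f; first by rewrite f0 gt_min; case/andP: e01 => _ ->.
move=> x /andP[fx x1]; have [fe fk] : 1 - x < e /\ (1 - x) < 
    (if odd k then (n.+1%:R - beta * y) / beta ^+ k.+1
                     else (beta * y - n%:R) / beta ^+ k.+1).
  by apply/andP; rewrite -lt_min -/f; lra.
have [|xk Tk] := IH x; first lra.
have xk01 : 0 < iter k T x <= 1 by apply: iter_negbeta_map_itv; lra.
have u0 : 0 <= beta ^+ k.+1 * (1 - x) by apply: mulr_ge0; lra.
have bTk : beta * iter k T x = beta * y - (-1) ^+ k * (beta ^+ k.+1 * (1 - x)).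
  rewrite Tk mulrBr; congr (_ - _); rewrite (exprNn beta) exprS.
  by move: ((-1) ^+ k) (beta ^+ k) => s b; ring.
have [|dx Tx] := @negbeta_branch (iter k T x) n xk01.
  rewrite bTk -signr_odd; case: (odd k) fk nyk;
    rewrite ltr_pdivlMr // [_ * beta ^+ _]mulrC => fk nyk.
    by rewrite expr1 mulN1r opprK; lra.
  by rewrite expr0 mul1r; lra.
rewrite !mkseqS xk; split.
  by congr rcons; apply: val_inj; rewrite /= -dy in dx *.
rewrite !iterS -/y Tx Ty bTk (exprNn beta) !exprS.
by move: ((-1) ^+ k) (beta ^+ k) => s b; ring.
Qed.

Lemma reaches_branch a l r : 0 <= l -> r <= 1 -> a%:R <= beta * l ->
  beta * r <= a.+1%:R ->
  reaches `]l, r[ [:: a] `](a.+1%:R - beta * r), (a.+1%:R - beta * l)[.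
Proof.
move=> l0 r1 al ra x; rewrite /= in_itv /= -natr1 in ra * => /andP[rx xl].
have b1 := beta_gt1; have b0 : 0 < beta by lra.
have br : beta * r <= beta by rewrite ler_piMr // ltW.
have a0 : 0 <= a%:R :> R by [].
set z := (a.+1%:R - x) / beta.
have bz : beta * z = a.+1%:R - x by rewrite mulrC divfK // gt_eqF.
have z01 : 0 < z <= 1.
  by rewrite -(pmulr_rgt0 z b0) -[z <= 1](ler_pM2l b0) bz -natr1; lra.
have [|dz Tz] := @negbeta_preimage a x z _ z01 bz; first by lra.
exists z; split=> //; last by rewrite /mkseq /= dz.
by rewrite /= in_itv /= -[_ < z](ltr_pM2l b0) -[_ < r](ltr_pM2l b0) bz -natr1;
  lra.
Qed.

(** * Intervals of which some iterate of [T] maps a part onto the unit interval *)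

Definition onto_unit U := exists w, reaches U w `]0, 1[.

Lemma onto_unit_subset U V : U `<=` V -> onto_unit U -> onto_unit V.
Proof. by move=> UV [w Uw]; exists w; exact: reaches_subset Uw. Qed.

Lemma onto_unit_subitv l r l' r' : l <= l' -> r' <= r ->
  onto_unit `]l', r'[ -> onto_unit `]l, r[.
Proof.
move=> ll rr; apply: onto_unit_subset => x;
  rewrite /= !in_itv /= => /andP[lx xr].
by rewrite (le_lt_trans ll lx) (lt_le_trans xr rr).
Qed.

Lemma onto_unit_branch (n : nat) l r : 0 <= l -> l < r -> r <= 1 ->
    n%:R <= beta * l -> beta * r <= n.+1%:R ->
    onto_unit `](n.+1%:R - beta * r), (n.+1%:R - beta * l)[ ->
  onto_unit `]l, r[.
Proof.
move=> l0 lr r1 nl rn [w sw].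
have b1 := beta_gt1; have b0 : 0 < beta by lra.
have lt_n : (n < (Num.truncn beta).+1)%N.
  rewrite -(ltr_nat R); have /andP[_ ] := trunc_itv (ltW b0);
    apply: le_lt_trans.
  by apply: le_trans nl _; rewrite ler_piMr ?ltW // (lt_le_trans lr).
exists ([:: Ordinal lt_n] ++ w); apply: reaches_cat sw.
exact: reaches_branch.
Qed.

Lemma onto_unit_full_branch (n : nat) l r :
  0 <= l -> r <= 1 -> beta * l <= n%:R -> n.+1%:R <= beta * r ->
  onto_unit `]l, r[.
Proof.
move=> l0 r1 ln nr; have b1 := beta_gt1; have b0 : 0 < beta by lra.
have bK (u : R) : beta * (u / beta) = u by rewrite mulrC divfK // gt_eqF.
apply: (@onto_unit_subitv _ _ (n%:R / beta) (n.+1%:R / beta)).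
- by rewrite -(ler_pM2l b0) bK.
- by rewrite -(ler_pM2l b0) bK.
apply: (@onto_unit_branch n); rewrite ?bK //.
- by rewrite divr_ge0 // ltW.
- by rewrite -(ltr_pM2l b0) !bK ltr_nat.
- by apply: le_trans r1; rewrite -(ler_pM2l b0) bK.
rewrite subrr -natr1 addrAC subrr add0r.
by exists [::]; exact: reaches_nil.
Qed.

(** Lengths cannot keep growing by the factor [rho] inside the unit interval, so the first
    alternative occurs after finitely many steps. *)
Lemma expanding_onto_unit rho : 1 < rho ->
    (forall l r, 0 <= l -> l < r -> r <= 1 -> (onto_unit `]l, r[) \/
       exists l' r', [/\ 0 <= l', l' < r', r' <= 1, rho * (r - l) <= r' - l' &
                         (onto_unit `]l', r'[ -> onto_unit `]l, r[)]) ->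
  forall l r, 0 <= l -> l < r -> r <= 1 -> onto_unit `]l, r[.
Proof.
move=> rho1 step l r l0 lr r1.
have [n] := exprn_unbounded (1 / (r - l)) rho1.
rewrite ltr_pdivrMr ?subr_gt0 //.
elim: n l r l0 lr r1 => [|n IH] l r l0 lr r1; first by rewrite expr0 mul1r; lra.
have [//|[l' [r' [l0' lr' r1' len]]]] := step l r l0 lr r1.
move=> + ltn; apply; apply: IH => //; apply: lt_le_trans ltn _.
rewrite exprSr -mulrA ler_pM2l // exprn_gt0 //; lra.
Qed.

(* Two steps along the first branch map a subinterval of ]0, e[ onto ]0, e'[
  with
   e' = beta^2 e - beta + 1, which expands away from the fixed point
   1 / (beta + 1). *)
Lemma onto_unit_at0 e : beta <= 2 -> 0 < e <= 1 -> 1 < e * (beta + 1) ->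
  onto_unit `]0, e[.
Proof.
move=> b2 e01 e1; have b1 := beta_gt1; have b0 : 0 < beta by lra.
have bK (u : R) : beta * (u / beta) = u by rewrite mulrC divfK // gt_eqF.
have bb1 : 1 < beta * beta by rewrite -[1]mulr1 ltr_pM //; lra.
(* [e * (beta + 1) - 1] is at most [beta], and passing from [e] to [e'] multiplies it by [beta^2];
   so [n] bounds the number of rounds. *)
have [n] := exprn_unbounded (beta / (e * (beta + 1) - 1)) bb1.
rewrite ltr_pdivrMr ?subr_gt0 //.
elim: n e e01 e1 => [|n IH] e e01 e1.
  by rewrite expr0 mul1r => ?; nra.
rewrite exprSr -mulrA => ltn.
have [be|be] := leP 1 (beta * e).
  by apply: (@onto_unit_full_branch 0); rewrite ?mulr0 //; lra.
apply: (@onto_unit_branch 0); rewrite ?mulr0 //; try lra.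
rewrite subr0; apply: (@onto_unit_subitv _ _ (1 - beta * e) (1 / beta)) => //.
  by rewrite -(ler_pM2l b0) bK mulr1 ltW.
apply: (@onto_unit_branch 0); rewrite ?bK //; try lra.
- by rewrite -(ltr_pM2l b0) bK; nra.
- by rewrite -(ler_pM2l b0) bK mulr1 ltW.
- by apply: mulr_ge0; lra.
by rewrite subrr; apply: IH; nra.
Qed.

(** An interval containing no full branch lies in one branch or crosses one branch point [c]; then
    the longer half is kept. For [beta > 2] one step gains [beta / 2 > 1]; for [beta <= 2] crossings
    need two steps, which gain [beta^2 / 2 > 1]. *)
Lemma open_onto_unit l r : beta + 1 < beta * beta ->
  0 <= l -> l < r -> r <= 1 -> onto_unit `]l, r[.
Proof.
move=> gold; have b1 := beta_gt1; have b0 : 0 < beta by lra.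
have bK (u : R) : beta * (u / beta) = u by rewrite mulrC divfK // gt_eqF.
have bM (u v : R) : u < v -> beta * u < beta * v by rewrite ltr_pM2l.
have bM' (u v : R) : u <= v -> beta * u <= beta * v by rewrite ler_pM2l.
have nS (n : nat) : n.+1%:R = n%:R + 1 :> R by rewrite natr1.
have [b2|b2] := ltP 2 beta.
  apply: (@expanding_onto_unit (beta / 2)); first by lra.
  move=> {}l {}r l0 lr r1; have bl0 : 0 <= beta * l by apply: mulr_ge0; lra.
  set n := Num.truncn (beta * l); have /andP[nl ln] := trunc_itv bl0.
  rewrite -/n in nl ln; have [rn|nr] := leP (beta * r) n.+1%:R.
    right; exists (n.+1%:R - beta * r), (n.+1%:R - beta * l).
    have := bM _ _ lr; have := nS n; split; try lra.
    exact: onto_unit_branch.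
  have [rn|{}nr] := leP (beta * r) n.+2%:R; last first.
    by left; apply: (@onto_unit_full_branch n.+1) => //; exact: ltW.
  set c := n.+1%:R / beta; have bc : beta * c = n.+1%:R by rewrite bK.
  have lc : l < c by rewrite -(ltr_pM2l b0) bc.
  have cr : c < r by rewrite -(ltr_pM2l b0) bc.
  right; have [lr2|lr2] := leP (r - c) (c - l).
    exists (n.+1%:R - beta * c), (n.+1%:R - beta * l).
    have := bM _ _ lc; have := nS n; have := bM' _ _ lr2.
    split; try lra.
    move=> oo; apply: (@onto_unit_subitv _ _ l c) => //; first exact: ltW.
    by apply: (@onto_unit_branch n) => //; [lra|rewrite bc].
  exists (n.+2%:R - beta * r), (n.+2%:R - beta * c).
  have := bM _ _ cr; have := nS n.+1; have := bM _ _ lr2.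
  split; try lra.
  move=> oo; apply: (@onto_unit_subitv _ _ c r) => //; first exact: ltW.
  by apply: (@onto_unit_branch n.+1) => //; [lra|rewrite bc].
have bb (u v : R) : u < v -> beta * beta * u < beta * beta * v.
  by rewrite -!mulrA => /bM/bM.
have bb' (u v : R) : u <= v -> beta * beta * u <= beta * beta * v.
  by rewrite -!mulrA => /bM'/bM'.
apply: (@expanding_onto_unit (beta * beta / 2)); first by lra.
move=> {}l {}r l0 lr r1; have bl0 : 0 <= beta * l by apply: mulr_ge0; lra.
set n := Num.truncn (beta * l); have /andP[nl ln] := trunc_itv bl0.
rewrite -/n in nl ln; have [rn|nr] := leP (beta * r) n.+1%:R.
  right; exists (n.+1%:R - beta * r), (n.+1%:R - beta * l).
  have := bM _ _ lr; have := nS n; split; try lra; last exact: onto_unit_branch.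
  have : (2 - beta) * (beta * r - beta * l) >= 0 by apply: mulr_ge0; lra.
  by lra.
(* As [beta * r <= 2], the only branch point that can be crossed is [1 / beta]. *)
have n0 : n = 0%N.
  case: n nl nr {ln} => [//|n] nl nr; exfalso.
  have := bM' _ _ r1; have := nS n.+1; have := nS n;
    have : 0 <= n%:R :> R by [].
  by lra.
rewrite {}n0 in nl ln nr.
set c := 1 / beta; have bc : beta * c = 1 by rewrite bK.
have bbc : beta * beta * c = beta by rewrite -mulrA bc mulr1.
have c0 : 0 < c by rewrite divr_gt0.
have c1 : c < 1 by rewrite -(ltr_pM2l b0) bc mulr1.
have lc : l < c by rewrite -(ltr_pM2l b0) bc.
have cr : c < r by rewrite -(ltr_pM2l b0) bc.
(* The image of the half kept has 0 or 1 as an endpoint, so the second step loses nothing unless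
   that image crosses [c] too. *)
have [lr2|lr2] := leP (r - c) (c - l).
  have onto0 : onto_unit `]0, (1 - beta * l)[ -> onto_unit `]l, r[.
    move=> oo; apply: (@onto_unit_subitv _ _ l c) => //; first exact: ltW.
    by apply: (@onto_unit_branch 0); rewrite ?bc ?subrr // ltW.
  have [be|be] := leP 1 (beta * (1 - beta * l)).
    by left; apply: onto0; apply: (@onto_unit_full_branch 0);
      rewrite ?mulr0 //; lra.
  right; exists (1 - beta * (1 - beta * l)), 1.
  have := bM _ _ lc; have := bb _ _ lc; have := bb' _ _ lr2.
  split; try lra.
  move=> oo; apply: onto0.
  by apply: (@onto_unit_branch 0); rewrite ?mulr0 ?subr0 //; lra.
have br := bM' _ _ r1.
have onto1 : onto_unit `](2 - beta * r), (2 - beta * c)[ -> onto_unit `]l, r[.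
  move=> oo; apply: (@onto_unit_subitv _ _ c r) => //; first exact: ltW.
  by apply: (@onto_unit_branch 1) => //; [exact: ltW|rewrite bc|lra].
have e1 : 2 - beta * c = 1 by lra.
rewrite {}e1 in onto1.
have [bf|bf] := leP 1 (beta * (2 - beta * r)).
  right; exists (2 - beta), (2 - beta * (2 - beta * r)).
  have := bM _ _ cr; have := bb _ _ lr2; have := bb _ _ cr.
  split; try lra.
  move=> oo; apply: onto1.
  by apply: (@onto_unit_branch 1); rewrite ?mulr1 //; lra.
(* The image now contains []c, 1[], whose image [](2 - beta), 1[] contains [](2 - beta), c[]; the
   first branch maps the latter onto []0, (beta - 1)^2[]. *)
left; apply: onto1; apply: (@onto_unit_subitv _ _ c 1) => //.
  by rewrite -(ler_pM2l b0) bc ltW.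
have bsq : beta * c - beta * (2 - beta) = (beta - 1) ^+ 2.
  by rewrite bc; ring.
have sq0 : 0 < (beta - 1) ^+ 2 by rewrite exprn_gt0 //; lra.
have sq1 : (beta - 1) ^+ 2 <= 1 by rewrite exprn_ile1 //; lra.
apply: (@onto_unit_branch 1); rewrite ?bc ?mulr1 //; try lra.
apply: (@onto_unit_subitv _ _ (2 - beta) c); try lra.
rewrite bc in bsq; apply: (@onto_unit_branch 0); rewrite ?bc //; try lra.
  by rewrite -(ltr_pM2l b0) bc; lra.
rewrite subrr bsq; apply: onto_unit_at0 => //; first by rewrite sq0.
(* The condition [1 < (beta - 1)^2 * (beta + 1)] amounts to [beta + 1 < beta * beta]. *)
by have := bM _ _ gold; rewrite expr2; lra.
Qed.

(** * Completions to the right above the golden mean *)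

Lemma reaches_zeros n : reaches `]0, 1[ (nseq n ord0) `]0, 1[.
Proof.
have b1 := beta_gt1; have b0 : 0 < beta by lra.
elim: n => [|n IH]; first exact: reaches_nil.
apply: (@reaches_cat _ `]0, 1[ _ [:: ord0]) => //.
have bc : beta * (1 / beta) = 1 by rewrite mulrC divfK // gt_eqF.
have c1 : 1 / beta <= 1 by rewrite -(ler_pM2l b0) bc mulr1 ltW.
have := @reaches_branch ord0 0 (1 / beta) (lexx _) c1.
rewrite mulr0 bc subrr subr0 => /(_ (lexx _) (lexx _)).
apply: reaches_subset => // x; rewrite /= !in_itv /= => /andP[-> x1] /=.
exact: lt_le_trans c1.
Qed.

Lemma prefix_completion : beta + 1 < beta * beta -> ~ odd_periodic om ->
  forall k, exists w, reaches `]0, 1[ (mkseq om k ++ w) `]0, 1[.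
Proof.
move=> gold noper k; have b1 := beta_gt1.
have [e e01 near1] := prefix_near1 noper k.
have [w sw] : onto_unit `](1 - e), 1[ by apply: open_onto_unit => //; lra.
(* The [k] zeros make the word at least [k] long, so that it begins with the common prefix
   [mkseq om k] of the points of [](1 - e), 1[]. *)
have swk := reaches_cat sw (reaches_zeros k); set w' := w ++ nseq k ord0 in swk.
have le_kw : (k <= size w')%N by rewrite size_cat size_nseq leq_addl.
have [|z [ze zw _]] := swk (1 / 2); first by rewrite /= in_itv /=; lra.
exists (drop k w'); have [|zk _] := near1 z.
  by move: ze; rewrite /= in_itv /= => /andP[-> /ltW].
have -> : mkseq om k ++ drop k w' = w'.
  rewrite -zk -[RHS](cat_take_drop k); congr (_ ++ _).
  rewrite -zw -[in RHS](subnK le_kw) addnC mkseq_expansionD.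
  by rewrite take_size_cat // size_mkseq.
apply: reaches_subset swk => // x; rewrite /= !in_itv /= => /andP[ex ->].
by rewrite andbT; lra.
Qed.

(** The gap must not depend on the word. The first branch is full, so zeros can be appended to reach
    a common length. *)
Lemma uniform_prefix_completion :
    beta + 1 < beta * beta -> ~ odd_periodic om ->
  forall K, exists2 t, (0 < t)%N & forall k, (k <= K)%N ->
    exists2 w, size w = t & reaches `]0, 1[ (mkseq om k ++ w) `]0, 1[.
Proof.
move=> gold noper.
have pad k t w : reaches `]0, 1[ (mkseq om k ++ w) `]0, 1[ -> (size w <= t)%N ->
    exists2 w', size w' = t & reaches `]0, 1[ (mkseq om k ++ w') `]0, 1[.
  move=> kw le_wt; exists (w ++ nseq (t - size w) ord0).
    by rewrite size_cat size_nseq subnKC.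
  by rewrite catA; apply: reaches_cat kw (reaches_zeros _).
elim=> [|K [t t0 IH]].
  have [w kw] := prefix_completion gold noper 0.
  exists (size w).+1 => // k; rewrite leqn0 => /eqP->.
  exact: pad kw (leqnSn _).
have [w kw] := prefix_completion gold noper K.+1.
exists (t + size w)%N; first by rewrite addn_gt0 t0.
move=> k; rewrite leq_eqVlt => /orP[/eqP->|/IH[u ut ku]].
  by apply: pad kw _; rewrite leq_addl.
by apply: pad ku _; rewrite ut leq_addr.
Qed.

Lemma per_specification_gold_lt (G : set (seq alphabet)) K :
    beta + 1 < beta * beta -> ~ odd_periodic om ->
    G `<=` language X -> G `<=` no_prefix_suffix om K ->
  per_specification X G.
Proof.
move=> gold noper GL GK.
have [t t0 kt] := uniform_prefix_completion gold noper K.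
(* Blocks are the words whose inverse branch maps []0, 1[] into itself; nothing is added on the
   left. *)
apply: (@blocks_per_specification _ X [set w | reaches `]0, 1[ w `]0, 1[] _ 0
  t).
- exact: negbeta_shift_closed.
- exact: negbeta_shift_invariant.
- move=> w; apply: reaches_language.
    by move=> x; rewrite /= !in_itv /= => /andP[-> /ltW].
  by exists (1 / 2); rewrite /= in_itv /=; lra.
- by move=> p q; exact: reaches_cat.
- by [].
move=> w Gw; have [k [p [le_kK wE kw]]] := longest_prefix_suffix (GK w Gw).
have [u ut ku] := kt k le_kK; exists [::], u; split=> //=.
rewrite wE -catA; apply: reaches_pullback => //; rewrite -wE; first exact: GL.
by rewrite size_mkseq.
Qed.

(** * The golden mean: completion on both sides in the even shift *)

Section GoldenMean.
Hypothesis golden : beta * beta = beta + 1.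

Lemma golden_bounds : 3 / 2 < beta < 2.
Proof.
have b1 := beta_gt1; have gold := golden.
by apply/andP; split; rewrite ltNge; apply/negP => b2; nra.
Qed.

Lemma golden_truncn : Num.truncn beta = 1%N.
Proof.
have b2 := golden_bounds; apply/eqP; rewrite truncn_eq; last by lra.
by lra.
Qed.

Lemma golden_ord_max : (ord_max : alphabet) = 1%N :> nat.
Proof. exact: golden_truncn. Qed.

Lemma golden_letter (z : R) :
  0 < z <= 1 -> 1 <= beta * z -> d z 0%N = ord_max /\ T z = 2 - beta * z.
Proof.
move=> z01 bz; have b2 := golden_bounds; have b0 : 0 < beta by lra.
have [|dz Tz] := @negbeta_branch z 1 z01.
  by rewrite bz; apply: le_lt_trans (_ : beta * 1 < 2); [rewrite ler_pM2l //;
    lra|lra].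
by split=> //; apply: val_inj; rewrite /= dz golden_truncn.
Qed.

(** [T 1 = 2 - beta] is the fixed point of [T] on the first branch. *)
Lemma golden_expansion1 k : mkseq om k.+1 = ord_max :: nseq k ord0.
Proof.
have b2 := golden_bounds; have gold := golden.
have bs : beta * (2 - beta) = beta - 1 by rewrite mulrBr gold; lra.
have one01 : 0 < (1 : R) <= 1 by lra.
have [|d1 T1] := @golden_letter 1 one01; first by lra.
rewrite mkseq_expansion_cons d1 T1 mulr1; congr (_ :: _).
have s01 : 0 < 2 - beta <= 1 by lra.
have [|ds Ts] := @negbeta_branch (2 - beta) 0 s01; first by rewrite bs; lra.
have Ts' : T (2 - beta) = 2 - beta by rewrite Ts bs; lra.
elim: k => //= k IH; rewrite mkseq_expansion_cons Ts' IH; congr (_ :: _).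
exact: val_inj.
Qed.

(** The points [2 - beta] and [beta - 1 = 1 / beta] form a Markov partition. On the two states []0,
    (2 - beta)[] and [](2 - beta), 1[], the letter [ord_max] stays in the upper one and [ord0]
    exchanges them. *)
Lemma golden_max_step : reaches `](2 - beta), 1[ [:: ord_max] `](2 - beta), 1[.
Proof.
have b2 := golden_bounds; have gold := golden.
have bc : beta * (beta - 1) = 1 by rewrite mulrBr gold; lra.
have := @reaches_branch ord_max (beta - 1) 1.
rewrite golden_ord_max bc mulr1 (_ : 2 - 1 = 1 :> R); last by lra.
move=> step; have : reaches `](beta - 1), 1[ [:: ord_max] `](2 - beta), 1[.
  by apply: step; rewrite ?golden_ord_max /=; lra.
by apply: reaches_subset => // x; rewrite /= !in_itv /=; lra.
Qed.

Lemma golden_zero_step : reaches `](2 - beta), 1[ [:: ord0] `]0, (2 - beta)[.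
Proof.
have b2 := golden_bounds; have gold := golden.
have bc : beta * (beta - 1) = 1 by rewrite mulrBr gold; lra.
have bs : beta * (2 - beta) = beta - 1 by rewrite mulrBr gold; lra.
have := @reaches_branch ord0 (2 - beta) (beta - 1).
rewrite bc bs subrr (_ : 1 - (beta - 1) = 2 - beta); last by lra.
move=> step; have : reaches `](2 - beta), (beta - 1)[ [:: ord0] `]0, (2 -
  beta)[.
  by apply: step; rewrite ?golden_ord_max /=; lra.
by apply: reaches_subset => // x; rewrite /= !in_itv /=; lra.
Qed.

Lemma golden_zero_back : reaches `]0, (2 - beta)[ [:: ord0] `](2 - beta), 1[.
Proof.
have b2 := golden_bounds; have gold := golden.
have bs : beta * (2 - beta) = beta - 1 by rewrite mulrBr gold; lra.
have := @reaches_branch ord0 0 (2 - beta).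
rewrite bs mulr0 subr0 (_ : 1 - (beta - 1) = 2 - beta); last by lra.
by apply=> /=; lra.
Qed.

Lemma golden_zeros k : reaches `](2 - beta), 1[ (nseq k ord0)
  (if odd k then [set` `]0, (2 - beta)[] else [set` `](2 - beta), 1[]).
Proof.
elim: k => [|k IH]; first exact: reaches_nil.
rewrite -(addn1 k) nseqD oddD addbT; apply: reaches_cat IH _.
by case: (odd k); [exact: golden_zero_back|exact: golden_zero_step].
Qed.

(** A run of zeros of odd length gets one more zero, to return to the upper state; letters [ord_max]
    bring the length to 2. *)
Lemma golden_completion k : exists2 w, size w = 2 &
  reaches `]0, 1[ (mkseq om k ++ w) `](2 - beta), 1[.
Proof.
have b2 := golden_bounds.
have sub (x : R) : x \in `](2 - beta), 1[ -> x \in `]0, 1[ by rewrite !in_itv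
  /=; lra.
case: k => [|k].
  exists [:: ord_max; ord_max] => //.
  apply: reaches_subset (reaches_cat golden_max_step golden_max_step) => //.
have := reaches_cat golden_max_step (@golden_zeros k).
rewrite golden_expansion1 cat1s; case: (odd k) => H.
  exists [:: ord0; ord_max] => //.
  apply: reaches_subset (reaches_cat H (reaches_cat golden_zero_back
    golden_max_step)) => //.
exists [:: ord_max; ord_max] => //.
apply: reaches_subset (reaches_cat H (reaches_cat golden_max_step
  golden_max_step)) => //.
Qed.

(** The last branch has image bounded below by [T 1 = 2 - beta]; so [a] is chosen to give a preimage
    [y >= 2 - beta], before which [ord_max] is allowed. *)
Lemma golden_left_completion w :
  language X w -> exists a, language X (ord_max :: a :: w).
Proof.
have b2 := golden_bounds; have gold := golden; have b0 : 0 < beta by lra.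
have bK (u : R) : beta * (u / beta) = u by rewrite mulrC divfK // gt_eqF.
have bs : beta * (2 - beta) = beta - 1 by rewrite mulrBr gold; lra.
have pre a x : 0 < x <= 1 -> 0 < a.+1%:R - x <= beta ->
    exists z, [/\ 0 < z <= 1, beta * z = a.+1%:R - x, d z 0%N = a & T z = x].
  move=> x01 ax; set z := (a.+1%:R - x) / beta.
  have z01 : 0 < z <= 1.
    by rewrite -(pmulr_rgt0 z b0) -[z <= 1](ler_pM2l b0) bK mulr1.
  have bz := bK (a.+1%:R - x).
  by have [dz Tz] := negbeta_preimage x01 z01 bz; exists z.
move=> /negbeta_languageP[x x01 xw].
have [a [y [y01 dy Ty ys]]] : exists a y,
    [/\ 0 < y <= 1, d y 0%N = a, T y = x & 2 - beta <= y].
  have [sx|xs] := leP (2 - beta) x.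
    have [|y [y01 byE dy Ty]] := pre ord_max x x01;
      first by rewrite golden_ord_max; lra.
    exists ord_max, y; split=> //;
      rewrite -(ler_pM2l b0) bs byE golden_ord_max; lra.
  have [|y [y01 byE dy Ty]] := pre ord0 x x01; first by rewrite /=; lra.
  by exists ord0, y; split=> //; rewrite -(ler_pM2l b0) bs byE /=; lra.
have [|z [z01 _ dz Tz]] := pre ord_max y y01; first by rewrite golden_ord_max;
  lra.
exists a; apply/negbeta_languageP; exists z => //.
by rewrite /= !mkseq_expansion_cons dz Tz dy Ty xw.
Qed.

Lemma per_specification_golden (G : set (seq alphabet)) :
  G `<=` language X -> per_specification X G.
Proof.
move=> GL; have b2 := golden_bounds; have gold := golden;
  have b0 : 0 < beta by lra.
(* Blocks map [U] into itself: they begin with [ord_max], so land in [U], and their right completion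
   accepts [](2 - beta), 1[], which contains [U]. *)
pose U : set R := [set z | 0 < z < 1 /\ d z 0%N = ord_max].
have Us z : U z -> z \in `](2 - beta), 1[.
  move=> [z01 dz]; have z01' : 0 < z <= 1 by lra.
  have [n [nz dn _ _]] := negbeta_branchP z01'.
  have bs : beta * (2 - beta) = beta - 1 by rewrite mulrBr gold; lra.
  have n1 : n = 1%N by rewrite -dn dz golden_ord_max.
  rewrite in_itv /= -(ltr_pM2l b0) bs; rewrite n1 in nz; lra.
apply: (@blocks_per_specification _ X [set w | reaches U w U] _ 2 2).
- exact: negbeta_shift_closed.
- exact: negbeta_shift_invariant.
- move=> w; apply: reaches_language.
    by move=> x [x01 _]; rewrite /= in_itv /=; lra.
  have c01 : 0 < beta - 1 <= 1 by lra.
  have [|dc _] := golden_letter c01; first by rewrite mulrBr gold; lra.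
  by exists (beta - 1); split=> //; lra.
- by move=> p q; exact: reaches_cat.
- by [].
move=> w /GL/golden_left_completion[a Law]; set l := [:: ord_max; a].
(* No suffix is longer than the word; this bound suffices, as [golden_completion] has length 2 for
   every [k]. *)
have size_no : no_prefix_suffix om (size (l ++ w)) (l ++ w).
  move=> k p lt_k lwE; move: lt_k; rewrite lwE size_cat size_mkseq.
  by rewrite ltnNge leq_addl.
have [k [p [_ wE kw]]] := longest_prefix_suffix size_no.
have [r r2 kr] := golden_completion k; exists l, r; split=> //.
have lwr : reaches `]0, 1[ (l ++ w ++ r) `](2 - beta), 1[.
  rewrite catA wE -catA; apply: reaches_pullback => //; rewrite -wE //.
  by rewrite size_mkseq.
move=> x /Us/lwr[z [z01 zw zx]]; exists z; split=> //; split.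
  by move: z01; rewrite /= in_itv.
by move: zw; rewrite /= mkseq_expansion_cons => -[].
Qed.

End GoldenMean.

Lemma per_specification_no_prefix_suffix (G : set (seq alphabet)) K :
    (1 + Num.sqrt 5) / 2 <= beta -> ~ odd_periodic om ->
    G `<=` language X -> G `<=` no_prefix_suffix om K ->
  per_specification X G.
Proof.
move=> beta_ge noper GL GK; have b1 := beta_gt1.
have s5 : Num.sqrt 5 ^+ 2 = 5 :> R by rewrite sqr_sqrtr //; lra.
have s0 : 0 <= Num.sqrt 5 :> R by exact: sqrtr_ge0.
(* The bound on [beta] says [Num.sqrt 5 <= 2 * beta - 1]; squaring gives the claim. *)
have gold : beta + 1 <= beta * beta.
  have : Num.sqrt 5 ^+ 2 <= (2 * beta - 1) ^+ 2.
    by rewrite ler_pXn2r ?nnegrE //; lra.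
  by rewrite s5 expr2; lra.
move: gold; rewrite le_eqVlt => /orP[/eqP gold|gold].
  exact: per_specification_golden.
exact: per_specification_gold_lt gold noper GL GK.
Qed.

End NegativeBetaShift.

(** * The decomposition of the language for a given [eps] *)

Theorem theoremB (R : realType) (beta : R)
    (beta_gt1 : 1 < beta)
    (beta_ge : (1 + Num.sqrt 5) / 2 <= beta)
    (d1_not_odd_periodic : ~ odd_periodic (negbeta_expansion beta 1))
    (eps : R) (eps_gt0 : 0 < eps) :
  exists G C : set (seq (negbeta_alphabet beta)),
    [/\ G `<=` language (negbeta_shift beta),
        C `<=` language (negbeta_shift beta),
        language (negbeta_shift beta) = lang_cat (negbeta_shift beta) G C,
        forall M : nat, (0 < M)%N ->
          per_specification (negbeta_shift beta)
            (lang_ext (negbeta_shift beta) G C M) &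
        (entropy R C <= eps%:E)%E].
Proof.
pose om := negbeta_expansion beta 1; pose X := negbeta_shift beta.
have eps1 : 0 < expR eps - 1 by rewrite subr_gt0 expR_gt1.
(* [N] is chosen so that the counting bound holds with [lam = expR eps]. *)
have [|N ltN] := @exprn_unbounded _ (1 / (expR eps - 1)) (expR eps).
  by rewrite expR_gt1.
rewrite ltr_pdivrMr // mulrC in ltN.
exists (language X `&` no_prefix_suffix om N), (language X `&` prefix_concat om
  N).
split.
- exact: subIsetl.
- exact: subIsetl.
- apply/seteqP; split=> [w Lw|w []//]; split=> //.
  have [v [c [Nv Nc wE]]] := prefix_decomposition om N w.
  rewrite wE in Lw *; exists v, c; split=> //; split=> //.
    by apply: (@language_factor _ _ [::] _ c) => //;
      exact: negbeta_shift_invariant.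
  apply: (@language_factor _ _ v _ [::]); last by rewrite cats0.
  exact: negbeta_shift_invariant.
- move=> M _; apply: (@per_specification_no_prefix_suffix _ _ beta_gt1 _ (N +
  M)) => //.
    by move=> w [].
  move=> w [_ [v [c [[_ Nv] [_ cM] ->]]]] k p lt_k.
  apply: (no_prefix_suffix_cat Nv); apply: leq_ltn_trans lt_k.
  by rewrite leq_add2l.
- by apply: entropy_prefix_concat_le eps_gt0 (ltW ltN) _; exact: subIsetr.
Qed.
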